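(* Assume NMA$^-$. Suppose that $K$ is a compact Hausdorff space such that every continuous image $L$ of $K$ with $w(L)<\mathfrak c$ carries a strictly positive measure. Then $K$ carries a strictly positive measure.
   Context: $\mathfrak c=2^{\omega}$ and $w(\cdot)$ denotes the weight of a topological space. A compact space $K$ carries a strictly positive measure if there is a regular Borel probability measure $\mu$ on $K$ such that $\mu(V)>0$ for every nonempty open set $V\subseteq K$. For a set $X$, $[X]^{<\mathfrak c}$ denotes the family of subsets of $X$ of cardinality $<\mathfrak c$. NMA$^-$ is the assertion: for every set $X$ there is a countably additive probability measure $\lambda$ defined on the power set $\mathcal P([X]^{<\mathfrak c})$ such that $\lambda(\{A\in[X]^{<\mathfrak c}: x\in A\})=1$ for every $x\in X$. *)

(* Defs.v *)
From HB Require Import structures.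
From mathcomp Require Import all_boot all_order all_algebra.
From mathcomp Require Import all_classical all_reals all_analysis.

Set Implicit Arguments.
Unset Strict Implicit.
Unset Printing Implicit Defensive.

Import Order.TTheory GRing.Theory Num.Theory.

Local Open Scope classical_set_scope.
Local Open Scope ring_scope.
Local Open Scope ereal_scope.

(* Cardinals are represented by sets, compared with [#<=]. *)
Definition card_lt (T U : Type) (A : set T) (B : set U) : Prop :=
  (A #<= B)%card /\ ~ (B #<= A)%card.

Definition continuum : set (set nat) := setT.

(* w(T) is the least cardinality of a base of T: the set B below is a base
   of cardinality w(T). *)
Definition weight_lt (T : topologicalType) (U : Type) (A : set U) : Prop :=
  exists B : set (set T),
    [/\ basis B, (forall C : set (set T), basis C -> (B #<= C)%card)
      & card_lt B A].

Definition small_subsets (X : Type) : set (set X) :=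
  [set A | card_lt A continuum].
Arguments small_subsets : clear implicits.

Lemma small_subsets_set0 (X : Type) : small_subsets X set0.
Proof.
split; first exact: card_ge0.
by rewrite card_le0 => /eqP/seteqP[/(_ setT I)].
Qed.

(* The type [X]^{<c}, equipped with its power set as sigma-algebra. *)
Definition small_subset (X : Type) : Type := set_type (small_subsets X).

HB.instance Definition _ (X : Type) := Choice.on (small_subset X).
HB.instance Definition _ (X : Type) := isPointed.Build (small_subset X)
  (SigSub (mem_set (small_subsets_set0 X)) : set_type (small_subsets X)).
HB.instance Definition _ (X : Type) :=
  @isMeasurable.Build default_measure_display (small_subset X)
    (@discrete_measurable (small_subset X)) (@discrete_measurable0 _)
    (@discrete_measurableC _) (@discrete_measurableU _).

Definition NMA_minus (R : realType) : Prop :=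
  forall X : Type, exists lambda : probability (small_subset X) R,
    forall x : X, lambda [set A : small_subset X | set_val A x] = 1.

(* Measurable types of the library are pointed, topological spaces are not.
   A space with a probability measure is nonempty, so that the choice of a
   point x, on which the sigma-algebra does not depend, is harmless. *)
Definition pointed_at (T : Type) (x : T) : Type := T.

HB.instance Definition _ (T : topologicalType) (x : T) :=
  Topological.on (pointed_at x).
HB.instance Definition _ (T : topologicalType) (x : T) :=
  isPointed.Build (pointed_at x) x.

Definition borel (T : topologicalType) (x : T) :=
  g_sigma_algebraType (@open (pointed_at x)).

Definition regular_measure (R : realType) (T : topologicalType) (x : T)
    (mu : probability (borel x) R) : Prop :=
  forall B : set T, measurable (B : set (borel x)) ->
    mu B = ereal_sup [set mu C | C in [set C : set T | compact C /\ C `<=` B]]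
    /\
    mu B = ereal_inf [set mu U | U in [set U : set T | open U /\ B `<=` U]].

Definition carries_strictly_positive_measure (R : realType)
    (T : topologicalType) : Prop :=
  exists (x : T) (mu : probability (borel x) R),
    regular_measure mu /\
    forall V : set T, open V -> V !=set0 -> 0 < mu V.

(* Main.v *)
(* For a set A of fewer than continuum many continuous functions on K, the
   image of K under the diagonal map of A has weight < c, hence carries a
   strictly positive measure mu_A; write p_A for the projection. With lambda
   given by NMA^- for the set of all continuous functions, put
     kappa(C) = the lambda-integral over A of mu_A(p_A(C)), for C closed.
   Integrability is free since every set of A's is lambda-measurable. If a
   continuous f separates C and D, then p_A(C) and p_A(D) are disjoint for
   every A containing f, that is for almost every A; so kappa is a content on
   the closed sets, and it extends to a regular Borel measure on K. For the
   same reason kappa {f >= 1/2} > 0 as soon as f takes the value 1. *)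

From HB Require Import structures.
Require Import Defs.
From mathcomp Require Import all_boot all_order all_algebra.
From mathcomp Require Import lra finmap.
From mathcomp Require Import all_classical all_reals all_analysis.

Set Implicit Arguments.
Unset Strict Implicit.
Unset Printing Implicit Defensive.

Import Order.TTheory GRing.Theory Num.Theory.
Import numFieldNormedType.Exports.

Local Open Scope classical_set_scope.

(** * Cardinal arithmetic *)

(** The default [u0] lets [f] be total on [T], whatever it does outside [A]. *)
Lemma card_le_injP (T U : Type) (u0 : U) (A : set T) (B : set U) :
  (A #<= B)%card <->
  exists f : T -> U, (forall x, A x -> B (f x)) /\
    (forall x y, A x -> A y -> f x = f y -> x = y).
Proof.
pose M := isPointed.Build {classic U} u0.
pose pU : pointedType := HB.pack {classic U} M.
split.
  move=> /(@pcard_leP T pU)/unsquash f; exists f; split.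
    by move=> x Ax; exact: funS.
  by move=> x y Ax Ay fxy; apply: (@inj _ _ _ f) fxy; rewrite inE.
move=> [f [fS fI]]; apply/(@pcard_leP T pU)/injfunPex; exists f => //.
by move=> x y; rewrite !inE; exact: fI.
Qed.

(* Zorn applied to sets of choice functions that pairwise differ at every
   member of F: for a maximal such set, evaluation at some member is onto. *)
Lemma least_card (T : Type) (F : set (set T)) : F !=set0 ->
  exists2 B, F B & forall C, F C -> (B #<= C)%card.
Proof.
move=> [C0 FC0].
pose P (D : set (set T -> T)) :=
  (forall d C, D d -> F C -> C (d C)) /\
  (forall d e C, D d -> D e -> F C -> d C = e C -> d = e).
have [|D [[DF Dinj] Dmax]] := @Zorn_bigcup (set T -> T) P.
  move=> G GP Gtot; split; first by move=> d C [D GD Dd]; apply: (GP D GD).1.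
  move=> d e C [D GD Dd] [E GE Ee].
  by have [DE|ED] := Gtot _ _ GD GE;
    [apply: (GP E GE).2 => //; exact: DE|apply: (GP D GD).2 => //; exact: ED].
(* If the values at [B] of the members of [D] exhaust [B], then [D] maps onto [B], while evaluation
   at any [C] in [F] embeds [D] in [C]. *)
have [[B FB BD]|nB] :=
    pselect (exists2 B, F B & B `<=` [set d B | d in D]).
  exists B => // C FC; apply: (card_le_trans (subset_card_le BD)).
  apply: (card_le_trans (card_image_le _ _)).
  have dI : {in D &, injective (fun d : set T -> T => d C)}.
    by move=> d e; rewrite !inE => Dd De; exact: (Dinj _ _ C).
  have := inj_card_eq dI; rewrite card_eq_le => /andP[_ DC].
  apply: (card_le_trans DC).
  by apply: subset_card_le => _ [d Dd <-]; exact: (DF d C).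
(* Otherwise [D] misses a point of every member of [F]; choosing such points gives a new function
   [d0], against maximality. *)
have ex C : F C -> exists x, C x /\ forall d, D d -> d C <> x.
  move=> FC; apply: contrapT => nx; apply: nB; exists C => // x Cx.
  apply: contrapT => nDx; apply: nx; exists x; split => // d Dd dx.
  by apply: nDx; exists d.
have [t0 _] := ex _ FC0.
have /choice[d0 d0P] : forall C, exists x,
    F C -> C x /\ forall d, D d -> d C <> x.
  move=> C; have [FC|nFC] := pselect (F C); last by exists t0.
  by have [x] := ex _ FC; exists x.
exfalso; apply: (Dmax (D `|` [set d0])).
  rewrite properEneq; split; last exact: subsetUl.
  apply/eqP => DE.
  have Dd0 : D d0 by rewrite DE; right.
  by apply: ((d0P _ FC0).2 d0 Dd0).
split; first by move=> d C [Dd|->] FC; [exact: (DF d C)|exact: (d0P _ FC).1].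
move=> d e C [Dd|->] [De|->] FC //; first exact: (Dinj _ _ C).
  by move=> /((d0P _ FC).2 _ Dd).
by move=> /esym /((d0P _ FC).2 _ De).
Qed.

(** [least_card] compares subsets of a single type, hence the copies of [A] and [B] in the sum
    type. *)
Lemma card_le_total (T U : Type) (A : set T) (B : set U) :
  (A #<= B)%card \/ (B #<= A)%card.
Proof.
have iA : (A #= @inl T U @` A)%card.
  by rewrite card_eq_sym; apply: inj_card_eq => x y _ _ [].
have iB : (B #= @inr T U @` B)%card.
  by rewrite card_eq_sym; apply: inj_card_eq => x y _ _ [].
have [|E + Emin] := @least_card _ [set @inl T U @` A; @inr T U @` B].
  by exists (@inl T U @` A); left.
rewrite (card_le_eql iA) (card_le_eqr iB) (card_le_eql iB) (card_le_eqr iA).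
by move=> [EE|EE]; rewrite -?EE; [left|right]; rewrite -?EE; apply: Emin;
  [right|left].
Qed.

Lemma infinite_set_neq (T : Type) (A : set T) : infinite_set A ->
  exists x y, [/\ A x, A y & x <> y].
Proof.
move=> Ainf; have [x Ax] := infinite_setN0 Ainf.
apply: contrapT => nxy; apply: Ainf.
apply: (sub_finite_set _ (finite_set1 x)) => y Ay /=.
by apply: contrapT => yx; apply: nxy; exists x, y; split => // /esym.
Qed.

Definition pairing_on (T : Type) (A S : set T) (f : T -> T -> T) :=
  [/\ S `<=` A, infinite_set S, forall x y, S x -> S y -> S (f x y) &
    forall x y x' y', S x -> S y -> S x' -> S y' -> f x y = f x' y' ->
      x = x' /\ y = y'].

(* The new values g (f (f (tag x) (tag y)) (f (h x) (h y))) lie in g @` S; h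
   retracts S `|` g @` S onto S and tag records which half a point is in. *)
Lemma pairing_on_extend (T : Type) (A S : set T) (f : T -> T -> T) :
  pairing_on A S f -> (S #<= A `\` S)%card ->
  exists S' f', [/\ pairing_on A S' f', S `<` S' &
    forall x y, S x -> S y -> f' x y = f x y].
Proof.
move=> [SA Sinf fS finj]; have [s0 [s1 [Ss0 Ss1 s01]]] := infinite_set_neq Sinf.
move=> /(card_le_injP s0)[g [gS ginj]].
have /choice[h hP] : forall x, exists y,
    (S x -> y = x) /\ ((g @` S) x -> S y /\ g y = x).
  move=> x.
  have [Sx|nSx] := pselect (S x).
    by exists x; split => // -[z Sz gz]; have [_] := gS z Sz; rewrite gz.
  have [[z Sz gz]|nz] := pselect ((g @` S) x); last by exists x.
  by exists z; split.
pose tag x := if pselect (S x) then s0 else s1.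
have tagS x : S (tag x) by rewrite /tag; case: pselect.
pose f' x y := if pselect (S x /\ S y) then f x y
  else g (f (f (tag x) (tag y)) (f (h x) (h y))).
have hS x : (S `|` g @` S) x -> S (h x).
  by move=> [Sx|gx]; [rewrite (hP x).1|have [] := (hP x).2 gx].
have f'1 x y : S x -> S y -> f' x y = f x y.
  by move=> Sx Sy; rewrite /f'; case: pselect => // -[].
have f'2 x y : ~ (S x /\ S y) ->
    f' x y = g (f (f (tag x) (tag y)) (f (h x) (h y))).
  by rewrite /f'; case: pselect.
have codeS x y : (S `|` g @` S) x -> (S `|` g @` S) y ->
    S (f (f (tag x) (tag y)) (f (h x) (h y))).
  by move=> /hS Sx /hS Sy; apply: (fS); apply: (fS).
have tagh x x' : (S `|` g @` S) x -> (S `|` g @` S) x' ->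
    tag x = tag x' -> h x = h x' -> x = x'.
  move=> xS xS'; rewrite /tag.
  case: pselect => Sx; case: pselect => Sx' tx hx.
  - by rewrite -((hP x).1 Sx) hx (hP x').1.
  - by case: s01.
  - by case: s01.
  - case: xS => // /(hP x).2[_ <-]; case: xS' => // /(hP x').2[_ <-].
    by rewrite hx.
exists (S `|` g @` S), f'; split => //; last first.
  rewrite properEneq; split; last exact: subsetUl.
  apply/eqP => SE; have [_] := gS s0 Ss0; apply.
  by rewrite SE; right; exists s0.
split.
- by move=> x [/SA//|[z Sz <-]]; have [] := gS z Sz.
- by apply: sub_infinite_set Sinf; exact: subsetUl.
- move=> x y xS yS; have [[Sx Sy]|nS] := pselect (S x /\ S y).
    by rewrite f'1//; left; apply: fS.
  by rewrite f'2//; right; exists (f (f (tag x) (tag y)) (f (h x) (h y))) => //;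
    exact: codeS.
- move=> x y x' y' xS yS xS' yS'.
  have [[Sx Sy]|nS] := pselect (S x /\ S y);
    have [[Sx' Sy']|nS'] := pselect (S x' /\ S y').
  + by rewrite !f'1//; exact: finj.
  + rewrite f'1// f'2// => E; have [_] := gS _ (codeS _ _ xS' yS').
    by rewrite -E; case; exact: fS.
  + rewrite f'2// f'1// => E; have [_] := gS _ (codeS _ _ xS yS).
    by rewrite E; case; exact: fS.
  + rewrite !f'2// => /ginj-/(_ (codeS _ _ xS yS) (codeS _ _ xS' yS')).
    move=> /finj[]; [exact: fS|apply: fS; exact: hS|exact: fS|
      apply: fS; exact: hS|].
    move=> /finj[]// tx ty; move=> /finj[]; [exact: hS..|] => hx hy.
    by split; apply: tagh.
Qed.

(* Hessenberg's theorem, by Zorn's lemma on pairings of infinite subsets. *)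
Lemma card_le_pairing (T : Type) (A : set T) : infinite_set A ->
  exists f : T -> T -> T, (forall x y, A x -> A y -> A (f x y)) /\
    (forall x y x' y', A x -> A y -> A x' -> A y' -> f x y = f x' y' ->
      x = x' /\ y = y').
Proof.
move=> Ainf; have [a0 Aa0] := infinite_setN0 Ainf.
(* The first pairing lives on the range of an injection of [nat] into [A], whose square is
   countable. *)
have [S0 [f0 Pf0]] : exists S f, pairing_on A S f.
  have /(infiniteP A)/(card_le_injP a0)[g [gA ginj]] := Ainf.
  have rinf : infinite_set (range g).
    apply/infiniteP/(card_le_injP a0); exists g; split; last exact: ginj.
    by move=> x _; exists x.
  have rc : countable (range g) by apply: card_le_trans (card_image_le _ _) _.
  have : (range g `*` range g #<= range g)%card.
    by apply: (card_le_trans (countableX rc rc)); exact/infiniteP.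
  move=> /(card_le_injP a0)[f [fS finj]].
  exists (range g), (fun x y => f (x, y)); split => //.
  - by move=> _ [n _ <-]; exact: gA.
  - by move=> x y gx gy; apply: fS.
  - move=> x y x' y' gx gy gx' gy' /(finj (x, y) (x', y')).
    by move=> /(_ (conj gx gy) (conj gx' gy'))[].
pose PT := {p : set T * (T -> T -> T) | pairing_on A p.1 p.2}.
pose leP (p q : PT) := (sval p).1 `<=` (sval q).1 /\
  forall x y, (sval p).1 x -> (sval p).1 y -> (sval q).2 x y = (sval p).2 x y.
pose t0 : PT := exist _ (S0, f0) Pf0.
have [||C Ctot|[[S f] /= Sf] Smax] := @ZL_preorder _ t0 (fun p q => `[< leP p q >]).
- by move=> p; apply/asboolP; split.
- move=> q p r /asboolP[qp fqp] /asboolP[pr fpr]; apply/asboolP; split.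
    exact: subset_trans pr.
  by move=> x y qx qy; rewrite fpr ?fqp//; exact: qp.
- have [[p0 Cp0]|C0] := pselect (C !=set0); last first.
    by exists t0 => s Cs; case: C0; exists s.
  pose S := \bigcup_(p in C) (sval p).1.
  (* The pairings in a chain agree where they overlap, so they glue to one function on the union. *)
  have /choice[F FP] : forall xy : T * T, exists z, forall p, C p ->
      (sval p).1 xy.1 -> (sval p).1 xy.2 -> z = (sval p).2 xy.1 xy.2.
    move=> [x y] /=.
    have [[p [Cp px py]]|np] :=
        pselect (exists p, [/\ C p, (sval p).1 x & (sval p).1 y]); last first.
      by exists x => p Cp px py; case: np; exists p.
    exists ((sval p).2 x y) => q Cq qx qy.
    by have [/asboolP[_ ->]|/asboolP[_ ->]] := Ctot _ _ Cp Cq.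
  have Sdir s t : S s -> S t -> exists2 p, C p & (sval p).1 s /\ (sval p).1 t.
    move=> [p Cp ps] [q Cq qt].
    by have [/asboolP[pq _]|/asboolP[qp _]] := Ctot _ _ Cp Cq;
      [exists q => //; split => //; exact: pq|exists p => //; split => //; exact: qp].
  have PS : pairing_on A S (fun x y => F (x, y)).
    split.
    - by move=> x [p _]; have [+ _ _ _] := svalP p; exact.
    - apply: (@sub_infinite_set _ (sval p0).1); last by have [] := svalP p0.
      by move=> x px; exists p0.
    - move=> x y /Sdir + /[dup] => h Sy.
      have [p Cp [px py]] := h _ Sy; exists p => //; rewrite (FP (x, y) p)//=.
      by have [_ _ + _] := svalP p; exact.
    - move=> x y x' y' Sx Sy Sx' Sy'.
      have [p Cp [px py]] := Sdir _ _ Sx Sy.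
      have [q Cq [qx qy]] := Sdir _ _ Sx' Sy'.
      have [r [Cr rx ry] [rx' ry']] : exists2 r,
          [/\ C r, (sval r).1 x & (sval r).1 y] & (sval r).1 x' /\ (sval r).1 y'.
        by have [/asboolP[pq _]|/asboolP[qp _]] := Ctot _ _ Cp Cq;
          [exists q|exists p]; split => //; (apply: pq + apply: qp).
      rewrite (FP (x, y) r)// (FP (x', y') r)//=.
      by have [_ _ _] := svalP r; exact.
  exists (exist _ (S, fun x y => F (x, y)) PS) => p Cp; apply/asboolP; split => /=.
    by move=> x px; exists p.
  by move=> x y px py; exact: (FP (x, y) p).
(* A maximal [S] does not embed in the rest of [A], as [pairing_on_extend] would enlarge it; hence
   the rest embeds in [S]. *)
have [AS|SAS] := card_le_total (A `\` S) S; last first.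
  have [S' [f' [Pf' SS' ff']]] := pairing_on_extend Sf SAS.
  have := Smax (exist _ (S', f') Pf').
  have le1 : leP (exist _ (S, f) Sf) (exist _ (S', f') Pf').
    by split => //=; exact: properW.
  move=> /(_ (introT (asboolP _) le1))/asboolP[/= S'S _].
  by case: SS' => _; exact.
have [SA Sinf fS finj] := Sf.
have [s0 [s1 [Ss0 Ss1 s01]]] := infinite_set_neq Sinf.
have [g [gS ginj]] := (card_le_injP s0 _ _).1 AS.
(* The tags [s0] and [s1] keep [S] and its complement apart, so [h] embeds all of [A] in [S]. *)
pose h x := if pselect (S x) then f s0 x else f s1 (g x).
have hS x : A x -> S (h x).
  by move=> Ax; rewrite /h; case: pselect => Sx; apply: fS => //; exact: gS.
have hinj x y : A x -> A y -> h x = h y -> x = y.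
  move=> Ax Ay; rewrite /h; case: pselect => Sx; case: pselect => Sy.
  - by move=> /finj[].
  - by move=> /finj[]//; exact: gS.
  - by move=> /finj[]//; [exact: gS|move=> /esym].
  - by move=> /finj[]//; [exact: gS..|move=> _ /ginj; exact].
exists (fun x y => f (h x) (h y)); split.
  by move=> x y /hS hx /hS hy; exact/SA/fS.
move=> x y x' y' Ax Ay Ax' Ay' /finj[]; [exact: hS..|].
by move=> /hinj -> // /hinj ->.
Qed.

(** Lists are coded by iterating a pairing; the length is paired in as well, since the code alone
    does not show where the list ends. *)
Lemma card_le_seq (T : eqType) (A : set T) : infinite_set A ->
  ([set s : seq T | [set` s] `<=` A] #<= A)%card.
Proof.
move=> Ainf; have [a0 Aa0] := infinite_setN0 Ainf.
have [f [fA finj]] := card_le_pairing Ainf.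
have /(infiniteP A)/(card_le_injP a0)[n [nA ninj]] := Ainf.
pose enc := foldr f a0.
have consA x s : [set` x :: s] `<=` A -> A x /\ [set` s] `<=` A.
  by move=> xsA; split => [|y ys]; apply: xsA; rewrite /= inE ?eqxx// ys orbT.
have encA s : [set` s] `<=` A -> A (enc s).
  by elim: s => //= x s IH /consA[Ax /IH]; exact: fA.
apply/(card_le_injP a0); exists (fun s => f (n (size s)) (enc s)); split.
  by move=> s sA; apply: fA; [exact: nA|exact: encA].
move=> s t sA tA /finj[]; [exact: nA|exact: encA|exact: nA|exact: encA|].
move=> /ninj-/(_ I I); elim: s t sA tA => [|x s IH] [|y t]//=.
move=> /consA[Ax sA] /consA[Ay tA] [st].
move=> /finj[]//; [exact: encA|exact: encA|].
by move=> -> /(IH _ sA tA st) ->.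
Qed.

Lemma countable_card_lt_continuum (T : Type) (A : set T) :
  countable A -> card_lt A continuum.
Proof.
move=> Ac; split.
  apply: (card_le_trans Ac); apply/(card_le_injP set0).
  exists (fun n => [set n]); split => // x y _ _ /seteqP[+ _].
  by move=> /(_ x erefl).
move=> /card_le_trans/(_ Ac) /(card_le_injP 0%N)[f [_ finj]].
(* Cantor's diagonal set for the supposed injection [f] of the power set of [nat] into [nat]. *)
pose D := [set n | exists2 E, f E = n & ~ E n].
have [Df|nDf] := pselect (D (f D)).
  by have [E /finj ED] := Df; rewrite ED.
by apply: (nDf); exists D.
Qed.

(** A finite intersection is named by a list in [D]. An infinite [D] has no more lists than
    elements; a finite one gives countably many intersections. *)
Lemma card_lt_finI_from (T : Type) (I : pointedType) (D : set I)
    (b : I -> set T) :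
  card_lt D continuum -> card_lt (finI_from D b) continuum.
Proof.
move=> [Dc cD]; have [Dfin|Dinf] := pselect (finite_set D).
  apply: countable_card_lt_continuum; apply: finI_from_countable.
  exact: finite_set_countable.
have le : (finI_from D b #<= D)%card.
  apply: (card_le_trans (card_image_le _ _)).
  apply: card_le_trans (card_le_seq Dinf).
  apply/(card_le_injP [::]); exists (fun X : {fset I} => enum_fset X); split.
    by move=> X XD x /= xX; apply/set_mem/XD.
  by move=> X Y _ _ XY; exact: val_inj.
split; first exact: card_le_trans Dc.
by move=> cle; apply: cD; exact: card_le_trans le.
Qed.

(** An infinite [A] contains a copy of the countable [B], so a pairing on [A] embeds the product in
    [A]. *)
Lemma card_lt_setXr (T U : Type) (A : set T) (B : set U) : countable B ->
  card_lt A continuum -> card_lt (A `*` B) continuum.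
Proof.
move=> Bc [Ac cA]; have [Afin|Ainf] := pselect (finite_set A).
  apply: countable_card_lt_continuum; apply: countableX => //.
  exact: finite_set_countable.
have [a0 Aa0] := infinite_setN0 Ainf.
have [f [fA finj]] := card_le_pairing Ainf.
have /(infiniteP A) nA := Ainf.
have /(card_le_injP a0)[n [{}nA ninj]] := card_le_trans Bc nA.
have le : (A `*` B #<= A)%card.
  apply/(card_le_injP a0); exists (fun x => f x.1 (n x.2)); split.
    by move=> [x y] [/= Ax By]; apply: fA => //; exact: nA.
  move=> [x y] [x' y'] [/= Ax By] [/= Ax' By'] /finj[]//; try exact: nA.
  by move=> -> /ninj ->.
split; first exact: card_le_trans Ac.
by move=> cle; apply: cA; exact: card_le_trans le.
Qed.

(** * Images of small weight *)

Local Open Scope ring_scope.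

Definition diag_image (R : realType) (K J : Type) (psi : J -> K -> R) : Type :=
  set_type (range (fun (x : K) (j : J) => psi j x)).

(** These rays are a subbase of the topology inherited from the product of [J] copies of [R];
    rational endpoints keep the subbase smaller than the continuum when [J] is. *)
Definition diag_ray (R : realType) (K J : Type) (psi : J -> K -> R)
    (i : J * (rat * bool)) : set (diag_image psi) :=
  [set y | if i.2.2 then ratr i.2.1 < set_val y i.1
           else set_val y i.1 < ratr i.2.1].

HB.instance Definition _ (R : realType) (K J : Type) (psi : J -> K -> R) :=
  Choice.on (diag_image psi).
HB.instance Definition _ (R : realType) (K J : Type) (psi : J -> K -> R) :=
  isSubBaseTopological.Build (diag_image psi) (range (@diag_ray R K J psi)) id.

(** [weight_lt] asks for a base of least cardinality; [least_card] supplies one, no larger than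
    [B]. *)
Lemma least_weight (T : topologicalType) (U : Type) (A : set U)
    (B : set (set T)) : basis B -> card_lt B A -> weight_lt T A.
Proof.
move=> Bb [BA AB].
have [|B0 B0b B0min] := @least_card _ [set C : set (set T) | basis C].
  by exists B.
exists B0; split => //; split; first exact: card_le_trans (B0min _ Bb) BA.
by move=> AB0; apply: AB; exact: card_le_trans AB0 (B0min _ Bb).
Qed.

Lemma diag_ray_open (R : realType) (K J : Type) (psi : J -> K -> R) i :
  open (diag_ray (psi := psi) i).
Proof.
exists [set diag_ray i]; last by rewrite bigcup_set1.
by move=> _ ->; apply: finI_from1; exists i.
Qed.

Lemma diag_basis (R : realType) (K J : Type) (psi : J -> K -> R) :
  basis (finI_from (range (@diag_ray R K J psi)) id).
Proof.
split.
  move=> U fU; exists [set U]; last by rewrite bigcup_set1.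
  by move=> _ ->.
move=> x U; rewrite nbhsE => -[V [[D DF <-] [W DW Wx]] VU].
exists W; first by split => //; exact: DF.
by apply: subset_trans VU => y Wy; exists W.
Qed.

Lemma weight_diag_image (R : realType) (K J : Type) (psi : J -> K -> R) :
  card_lt [set: J] continuum -> weight_lt (diag_image psi) continuum.
Proof.
move=> Jc; apply: least_weight (@diag_basis R K J psi) _.
apply: card_lt_finI_from.
have [le cl] : card_lt ([set: J] `*` [set: rat * bool]) continuum.
  exact: card_lt_setXr (countableP _) Jc.
have le' := card_image_le (@diag_ray R K J psi) setT.
rewrite setXTT in le cl.
split; first exact: card_le_trans le.
by move=> cl'; apply: cl; exact: card_le_trans le'.
Qed.

(** By density of the rationals, every ball around [h y] contains an interval around [h y] with
    rational endpoints. *)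
Lemma continuous_rat_rays (R : realType) (T : topologicalType) (h : T -> R) :
  (forall q : rat, open [set y | ratr q < h y]) ->
  (forall q : rat, open [set y | h y < ratr q]) -> continuous h.
Proof.
move=> hr hl y; apply/cvgrPdist_lt => e e0.
have [q1 + yq1] : exists2 q : rat, h y - e < ratr q & ratr q < h y.
  have /rat_in_itvoo[q] : h y - e < h y by rewrite ltrBlDr ltrDl.
  by rewrite in_itv => /andP[]; exists q.
have [q2 yq2 +] : exists2 q : rat, h y < ratr q & ratr q < h y + e.
  have /rat_in_itvoo[q] : h y < h y + e by rewrite ltrDl.
  by rewrite in_itv => /andP[]; exists q.
move=> q2e q1e; near=> z.
have z1 : ratr q1 < h z
  by near: z; apply: (open_nbhs_nbhs (conj (hr q1) _)).
have z2 : h z < ratr q2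
  by near: z; apply: (open_nbhs_nbhs (conj (hl q2) _)).
rewrite ltr_distlC; apply/andP; split; first exact: lt_trans z1.
exact: lt_trans q2e.
Unshelve. all: by end_near. Qed.

Lemma diag_coord_continuous (R : realType) (K J : Type) (psi : J -> K -> R) j :
  continuous (fun y : diag_image psi => set_val y j).
Proof.
apply: continuous_rat_rays => q.
  exact: (@diag_ray_open R K J psi (j, (q, true))).
exact: (@diag_ray_open R K J psi (j, (q, false))).
Qed.

Lemma diag_image_hausdorff (R : realType) (K J : Type) (psi : J -> K -> R) :
  hausdorff_space (diag_image psi).
Proof.
rewrite open_hausdorff => x y xy.
have [j xyj] : exists j, set_val x j != set_val y j.
  apply: contrapT => nj; case/eqP: xy; apply: val_inj.
  by apply/funext => j; apply/eqP/negP => /negP xyj; apply: nj; exists j.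
have := @norm_hausdorff _ R; rewrite open_hausdorff => /(_ _ _ xyj)[[U V]] /=.
rewrite !inE => -[Ux Vy] [oU oV UV].
exists ((fun z : diag_image psi => set_val z j) @^-1` U,
        (fun z : diag_image psi => set_val z j) @^-1` V); rewrite /= ?inE//.
split.
- by apply: open_comp => // z _; exact: diag_coord_continuous.
- by apply: open_comp => // z _; exact: diag_coord_continuous.
- by rewrite -preimage_setI UV preimage_set0.
Qed.

(** [L] is the diagonal image, and [psi j] is [p] followed by the [j]-th coordinate. This
    factorisation makes sets separated by [psi j] have disjoint images. *)
Lemma small_weight_image (R : realType) (K : topologicalType) (J : Type)
    (psi : J -> K -> R) : (forall j, continuous (psi j)) ->
  card_lt [set: J] continuum ->
  exists (L : topologicalType) (p : K -> L),
    [/\ hausdorff_space L, continuous p, range p = [set: L],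
      weight_lt L continuum &
      forall j, exists2 h : L -> R, continuous h & psi j = h \o p].
Proof.
move=> psic Jc; pose F := fun (x : K) (j : J) => psi j x.
have Fr x : F x \in range F by apply/mem_set; exists x.
exists (diag_image psi), (fun x => SigSub (Fr x)); split.
- exact: diag_image_hausdorff.
- apply/continuousP => _ [D DF <-]; rewrite preimage_bigcup.
  apply: bigcup_open => U /DF[E ED <-]; rewrite preimage_bigcap.
  rewrite bigcap_fset big_seq.
  apply: (big_ind open) => [|A B|A /ED/set_mem[[j [q b]] _ <-]].
  - exact: openT.
  - exact: openI.
  - case: b.
    + by apply: (@open_comp _ _ (psi j) [set r | ratr q < r]) => // x _; exact: psic.
    + by apply: (@open_comp _ _ (psi j) [set r | r < ratr q]) => // x _; exact: psic.
- apply/seteqP; split => // y _; have [x _ xy] := set_mem (valP y).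
  by exists x => //; exact: val_inj.
- exact: weight_diag_image.
- by move=> j; exists (fun y => set_val y j) => //; exact: diag_coord_continuous.
Qed.

(** * From contents on closed sets to regular measures *)

Local Open Scope ereal_scope.

(** A normalised content in the sense of Halmos, with closed sets for compact ones: [k] accepts
    every set, but monotonicity and additivity are required on closed sets only. *)
Record closed_content (R : realType) (T : topologicalType)
    (k : set T -> \bar R) : Prop := ClosedContent {
  content_ge0 : forall C, 0 <= k C;
  content0 : k set0 = 0;
  contentT : k [set: T] = 1;
  content_le : forall C D, closed C -> closed D -> C `<=` D -> k C <= k D;
  contentU_le : forall C D, closed C -> closed D -> k (C `|` D) <= k C + k D;
  contentU_disj : forall C D, closed C -> closed D -> C `&` D = set0 ->
    k (C `|` D) = k C + k D
}.

Definition inner_content (R : realType) (T : topologicalType)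
    (k : set T -> \bar R) (U : set T) : \bar R :=
  ereal_sup [set k C | C in [set C | closed C /\ C `<=` U]].

(** The outer measure induced by a content: open sets are measured from inside by closed sets,
    arbitrary sets from outside by open ones. *)
Definition outer_content (R : realType) (T : topologicalType)
    (k : set T -> \bar R) (E : set T) : \bar R :=
  ereal_inf [set inner_content k U | U in [set U | open U /\ E `<=` U]].

Lemma le_inner_content (R : realType) (T : topologicalType)
    (k : set T -> \bar R) (C U : set T) :
  closed C -> C `<=` U -> k C <= inner_content k U.
Proof. by move=> cC CU; apply: ereal_sup_ubound; exists C. Qed.

Lemma inner_content_homo (R : realType) (T : topologicalType)
    (k : set T -> \bar R) (U V : set T) :
  U `<=` V -> inner_content k U <= inner_content k V.
Proof.
move=> UV; apply: ereal_sup_le => _ [C [cC CU] <-]; exists C => //.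
by split => //; exact: subset_trans UV.
Qed.

Lemma outer_content_homo (R : realType) (T : topologicalType)
    (k : set T -> \bar R) (E F : set T) :
  E `<=` F -> outer_content k E <= outer_content k F.
Proof.
move=> EF; apply: le_ereal_inf_tmp => _ [U [oU FU] <-].
by apply: ereal_inf_lbound; exists U => //; split => //; exact: subset_trans FU.
Qed.

Lemma outer_content_open (R : realType) (T : topologicalType)
    (k : set T -> \bar R) (U : set T) :
  open U -> outer_content k U = inner_content k U.
Proof.
move=> oU; apply/eqP; rewrite eq_le; apply/andP; split.
  by apply: ereal_inf_lbound; exists U => //; split.
by apply: le_ereal_inf_tmp => _ [V [oV UV] <-]; exact: inner_content_homo.
Qed.

Lemma inner_content_ge0 (R : realType) (T : topologicalType)
    (k : set T -> \bar R) (U : set T) :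
  closed_content k -> 0 <= inner_content k U.
Proof.
move=> kc; rewrite -(content0 kc); apply: le_inner_content => //.
exact: closed0.
Qed.

Lemma inner_content_le1 (R : realType) (T : topologicalType)
    (k : set T -> \bar R) (U : set T) :
  closed_content k -> inner_content k U <= 1.
Proof.
move=> kc; apply: ge_ereal_sup => _ [C [cC _] <-].
by rewrite -(contentT kc); apply: (content_le kc) => //; exact: closedT.
Qed.

Lemma outer_content_ge0 (R : realType) (T : topologicalType)
    (k : set T -> \bar R) (E : set T) :
  closed_content k -> 0 <= outer_content k E.
Proof.
by move=> kc; apply: le_ereal_inf_tmp => _ [U _ <-]; exact: inner_content_ge0.
Qed.

Lemma outer_content_le1 (R : realType) (T : topologicalType)
    (k : set T -> \bar R) (E : set T) :
  closed_content k -> outer_content k E <= 1.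
Proof.
move=> kc; apply: le_trans (inner_content_le1 setT kc).
by apply: ereal_inf_lbound; exists setT => //; split => //; exact: openT.
Qed.

Lemma outer_contentT (R : realType) (T : topologicalType)
    (k : set T -> \bar R) :
  closed_content k -> outer_content k setT = 1.
Proof.
move=> kc; apply/eqP; rewrite eq_le outer_content_le1//=.
rewrite outer_content_open; last exact: openT.
by rewrite -(contentT kc); apply: le_inner_content => //; exact: closedT.
Qed.

Lemma outer_content0 (R : realType) (T : topologicalType)
    (k : set T -> \bar R) :
  closed_content k -> outer_content k set0 = 0.
Proof.
move=> kc; apply/eqP; rewrite eq_le outer_content_ge0// andbT.
rewrite outer_content_open; last exact: open0.
apply: ge_ereal_sup => _ [C [_ C0] <-].
by rewrite (_ : C = set0) ?(content0 kc)//; apply/seteqP; split.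
Qed.

Lemma outer_content_fin_num (R : realType) (T : topologicalType)
    (k : set T -> \bar R) (E : set T) :
  closed_content k -> outer_content k E \is a fin_num.
Proof.
move=> kc; rewrite ge0_fin_numE ?outer_content_ge0//.
exact: le_lt_trans (outer_content_le1 E kc) (ltry _).
Qed.

Lemma outer_content_approx (R : realType) (T : topologicalType)
    (k : set T -> \bar R) (E : set T) (e : R) : closed_content k ->
  (0 < e)%R -> exists U, [/\ open U, E `<=` U &
    inner_content k U <= outer_content k E + e%:E].
Proof.
move=> kc e0.
have [_ [U [oU EU] <-] lt] := lb_ereal_inf_adherent e0 (outer_content_fin_num E kc).
by exists U; split => //; exact: ltW.
Qed.

(** The parts of [C] outside [U] and outside [V] are disjoint and closed, so normality encloses them
    in disjoint open [P] and [Q]. Removing [P], respectively [Q], from [C] leaves two pieces that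
    cover [C]. *)
Lemma closed_subsetU_split (R : realType) (T : topologicalType)
    (C U V : set T) : normal_space T -> closed C -> open U -> open V ->
  C `<=` U `|` V -> exists C1 C2, [/\ closed C1, closed C2, C1 `<=` U,
    C2 `<=` V & C = C1 `|` C2].
Proof.
move=> nT cC oU oV CUV.
have cU : closed (C `&` ~` U) by apply: closedI => //; exact: open_closedC.
have cV : closed (C `&` ~` V) by apply: closedI => //; exact: open_closedC.
have CC0 : (C `&` ~` U) `&` (C `&` ~` V) = set0.
  by apply/seteqP; split => // x [[Cx nU] [_ nV]]; have [] := CUV _ Cx.
have [P [Q [oP oQ UP VQ PQ]]] := (@normal_openP R T).1 nT _ _ cU cV CC0.
exists (C `&` ~` P), (C `&` ~` Q); split.
- by apply: closedI => //; exact: open_closedC.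
- by apply: closedI => //; exact: open_closedC.
- by move=> x [Cx nPx]; apply: contrapT => nUx; apply: nPx; exact: UP.
- by move=> x [Cx nQx]; apply: contrapT => nVx; apply: nQx; exact: VQ.
- rewrite -setIUr -setCI PQ setC0 setIT//.
Qed.

Lemma inner_contentU (R : realType) (T : topologicalType)
    (k : set T -> \bar R) (U V : set T) : normal_space T ->
  closed_content k -> open U -> open V ->
  inner_content k (U `|` V) <= inner_content k U + inner_content k V.
Proof.
move=> nT kc oU oV; apply: ge_ereal_sup => _ [C [cC CUV] <-].
have [C1 [C2 [cC1 cC2 C1U C2V ->]]] := closed_subsetU_split R nT cC oU oV CUV.
by apply: (le_trans (contentU_le kc cC1 cC2)); apply: leeD; exact: le_inner_content.
Qed.

(** A closed set inside the union is compact, so finitely many [U n] cover it; finite unions follow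
    by induction from [inner_contentU]. *)
Lemma inner_content_bigcup (R : realType) (T : topologicalType)
    (k : set T -> \bar R) (U : nat -> set T) : normal_space T ->
  compact [set: T] -> closed_content k -> (forall n, open (U n)) ->
  inner_content k (\bigcup_n U n) <= \sum_(n <oo) inner_content k (U n).
Proof.
move=> nT cT kc oU; apply: ge_ereal_sup => _ [C [cC CU] <-].
(* A point of [C] gives access to [pointed_at x], where [compact_cover] is applied. *)
have [->|/set0P[x _]] := eqVneq C set0.
  rewrite (content0 kc); apply: nneseries_ge0 => n _ _.
  exact: inner_content_ge0.
have : cover_compact C.
  have : @compact (pointed_at x) C by exact: subclosed_compact cT _.
  by rewrite compact_cover.
move=> /(_ nat setT U)[//|//|D _ CD].
pose n := (\max_(i <- D) i).+1.
have CUn : C `<=` \big[setU/set0]_(i < n) U i.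
  move=> y /CD[i /= iD Uiy]; rewrite -bigcup_mkord; exists i => //=.
  by rewrite /n ltnS; exact: (@leq_bigmax_seq _ _ xpredT id).
apply: (@le_trans _ _ (\sum_(0 <= i < n) inner_content k (U i))); last first.
  by apply: nneseries_lim_ge => i _ _; exact: inner_content_ge0.
have le m : inner_content k (\big[setU/set0]_(i < m) U i) <=
    \sum_(0 <= i < m) inner_content k (U i).
  elim: m => [|m IH].
    rewrite big_ord0 big_nil -outer_content_open; last exact: open0.
    by rewrite outer_content0.
  rewrite big_ord_recr big_nat_recr//=.
  apply: (le_trans (inner_contentU nT kc _ (oU m))); last exact: leeD.
  by rewrite -bigcup_mkord; apply: bigcup_open => i _; exact: oU.
exact: le_trans (le_inner_content k cC CUn) (le n).
Qed.

(** Each [A n] is enclosed in an open [U n] with error [e / 2 ^ n.+1]; the errors add up to [e]. *)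
Lemma outer_content_sigma_subadditive (R : realType) (T : topologicalType)
    (k : set T -> \bar R) : normal_space T -> compact [set: T] ->
  closed_content k -> sigma_subadditive (outer_content k).
Proof.
move=> nT cT kc A; apply/lee_addgt0Pr => e e0.
apply: (le_trans _ (epsilon_trick _ _ (ltW e0))); last first.
  by move=> n; exact: outer_content_ge0.
have /choice[U UP] : forall n, exists U, [/\ open U, A n `<=` U &
    inner_content k U <= outer_content k (A n) + (e / (2 ^ n.+1)%:R)%:E].
  by move=> n; apply: outer_content_approx => //; rewrite divr_gt0// ltr0n expn_gt0.
have oU n : open (U n) by have [] := UP n.
apply: (@le_trans _ _ (outer_content k (\bigcup_n U n))).
  apply: outer_content_homo => x [n _ Anx]; exists n => //.
  by have [_ + _] := UP n; exact.
rewrite outer_content_open; last by apply: bigcup_open => n _; exact: oU.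
apply: (le_trans (inner_content_bigcup nT cT kc oU)).
apply: lee_nneseries => n _ *; first exact: inner_content_ge0.
by have [] := UP n.
Qed.

(** This is Caratheodory's condition for [U]. Given an open [V] around [E], take a closed [C] in [V]
    and [U], then a closed [D] in [V] off [C]: being disjoint, they satisfy
    [k D + k C <= inner_content k V]. Take suprema over [D], then over [C]. *)
Lemma outer_content_open_split (R : realType) (T : topologicalType)
    (k : set T -> \bar R) (U E : set T) : closed_content k -> open U ->
  outer_content k (E `&` U) + outer_content k (E `&` ~` U) <=
  outer_content k E.
Proof.
move=> kc oU; apply: le_ereal_inf_tmp => _ [V [oV EV] <-].
apply: (@le_trans _ _ (outer_content k (V `&` U) + outer_content k (V `&` ~` U))).
  by apply: leeD; apply: outer_content_homo; exact: setSI.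
rewrite [outer_content k (V `&` U)]outer_content_open; last exact: openI.
rewrite -leeBrDr; last exact: outer_content_fin_num.
apply: ge_ereal_sup => _ [C [cC CVU] <-].
rewrite leeBrDr; last exact: outer_content_fin_num.
have oVC : open (V `&` ~` C) by apply: openI => //; exact: closed_openC.
have kCfin : k C \is a fin_num.
  rewrite ge0_fin_numE ?(content_ge0 kc)//.
  by rewrite (le_lt_trans (le_inner_content k cC (@subsetT _ C)))//
    (le_lt_trans (inner_content_le1 _ kc))// ltry.
apply: (@le_trans _ _ (k C + inner_content k (V `&` ~` C))).
  apply: leeD => //; rewrite -outer_content_open//; apply: outer_content_homo.
  by move=> x [Vx nUx]; split => // /CVU[].
rewrite addeC -leeBrDr//; apply: ge_ereal_sup => _ [D [cD DVC] <-].
rewrite leeBrDr//.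
have DC : D `&` C = set0 by apply/seteqP; split => // x [/DVC[]].
rewrite -(contentU_disj kc cD cC DC); apply: le_inner_content.
  exact: closedU.
by move=> x [/DVC[]|/CVU[]].
Qed.

(** Open sets are Caratheodory measurable, hence Borel sets are, and the outer content restricts to
    a measure on them. The inequality between [k] and [mu] is what carries positivity over to
    [mu]. *)
Lemma closed_content_measure (R : realType) (T : topologicalType) (x : T)
    (k : set T -> \bar R) : hausdorff_space T -> compact [set: T] ->
  closed_content k ->
  exists2 mu : probability (borel x) R, regular_measure mu &
    forall C V : set T, closed C -> open V -> C `<=` V -> k C <= mu V.
Proof.
move=> hT cT kc; have nT := compact_normal hT cT.
pose om := isOuterMeasure.Build R (pointed_at x) (outer_content k)
  (@outer_content0 R T k kc) (fun E => @outer_content_ge0 R T k E kc)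
  (@outer_content_homo R T k) (outer_content_sigma_subadditive nT cT kc).
pose m : {outer_measure set (pointed_at x) -> \bar R} :=
  HB.pack (outer_content k : set (pointed_at x) -> \bar R) om.
have mE E : m E = outer_content k E by [].
have bm (B : set (borel x)) : measurable B -> m.-caratheodory B.
  apply: smallest_sub.
    split; first exact: caratheodory_measurable_set0.
      by move=> A mA; rewrite setTD; exact: caratheodory_measurable_setC.
    by move=> A mA; exact: caratheodory_measurable_bigcup.
  move=> U oU; apply: le_caratheodory_measurable => E.
  exact: outer_content_open_split.
have msa : semi_sigma_additive (m : set (borel x) -> \bar R).
  move=> F mF tF mUF.
  by apply: (@caratheodory_measure_sigma_additive _ _ m) => // [i|]; exact: bm.
pose mm := isMeasure.Build _ (borel x) R (m : set (borel x) -> \bar R)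
  (@outer_content0 R T k kc) (fun E => @outer_content_ge0 R T k E kc) msa.
pose mu0 : {measure set (borel x) -> \bar R} :=
  HB.pack (m : set (borel x) -> \bar R) mm.
have muT : mu0 setT = 1 by exact: outer_contentT.
pose pm := Measure_isProbability.Build _ (borel x) R mu0 muT.
pose mu : probability (borel x) R := HB.pack (m : set (borel x) -> \bar R) mm pm.
have muE (E : set T) : mu E = outer_content k E by [].
exists mu; last first.
  by move=> C V cC oV CV; rewrite muE outer_content_open//; exact: le_inner_content.
have outer_regular (B : set T) : mu B =
    ereal_inf [set mu U | U in [set U : set T | open U /\ B `<=` U]].
  transitivity (outer_content k B) => //; congr ereal_inf.
  by apply/seteqP; split => _ [U [oU BU] <-]; exists U => //;
    rewrite -?outer_content_open// ?outer_content_open.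
move=> B mB; split; last exact: outer_regular.
apply/eqP; rewrite eq_le; apply/andP; split; last first.
  by apply: ge_ereal_sup => _ [C [cC CB] <-]; exact: outer_content_homo.
apply/lee_addgt0Pr => e e0.
(* Inner regularity comes by complements: the complement of [U] is compact, lies in [B], and loses
   at most [e] of its measure. *)
have [U [oU BU Ule]] := outer_content_approx (~` B) kc e0.
have mU : measurable (U : set (borel x)) by exact: sub_sigma_algebra.
have le1 : mu (~` U) <= ereal_sup [set mu C | C in [set C : set T | compact C /\ C `<=` B]].
  apply: ereal_sup_ubound; exists (~` U) => //; split.
    exact: (subclosed_compact (open_closedC oU) cT).
  by rewrite -[B]setCK; exact: subsetC.
apply: (le_trans _ (leeD le1 (lexx _))).
have fB : mu (~` B) \is a fin_num by exact: outer_content_fin_num.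
have fU : mu U \is a fin_num by exact: outer_content_fin_num.
rewrite probability_setC//.
have -> : mu B = 1 - mu (~` B).
  by rewrite -[in LHS](setCK B) probability_setC//; exact: measurableC.
rewrite -outer_content_open// -!muE in Ule.
move: fB fU Ule; case: (mu (~` B)) => // b _; case: (mu U) => // u _.
by rewrite -!EFinD !lee_fin => ?; lra.
Qed.

(** * Averaging the measures of the images *)

(* A content that need only be additive across closed sets separated by some
   member of S: what the measure of an image of K induces on K. *)
Record separated_content (R : realType) (T : topologicalType)
    (S : set (T -> R)) (k : set T -> \bar R) : Prop := SeparatedContent {
  scontent_ge0 : forall C, 0 <= k C;
  scontent0 : k set0 = 0;
  scontentT : k [set: T] = 1;
  scontent_le : forall C D, closed C -> closed D -> C `<=` D -> k C <= k D;
  scontentU_le : forall C D, closed C -> closed D -> k (C `|` D) <= k C + k D;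
  scontentU_sep : forall f C D, S f -> closed C -> closed D ->
    f @` C `<=` [set 0%R] -> f @` D `<=` [set 1%R] ->
    k (C `|` D) = k C + k D;
  scontent_gt0 : forall f x, S f -> f x = 1%R ->
    0 < k [set y | (2^-1 <= f y)%R]
}.

(** Here [k C] is the measure of the image of [C] under the diagonal map [p] of [S], through which
    every member of [S] factors. *)
Lemma image_separated_content (R : realType) (K : topologicalType)
    (images : forall (L : topologicalType) (f : K -> L),
      hausdorff_space L -> continuous f -> range f = [set: L] ->
      weight_lt L continuum -> carries_strictly_positive_measure R L)
    (S : set (K -> R)) : compact [set: K] -> card_lt S continuum ->
  (forall f, S f -> continuous f) ->
  exists k : set K -> \bar R, separated_content S k.
Proof.
move=> cK Sc Scont.
have [||L [p [hL cp rp wL ph]]] :=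
  @small_weight_image R K (set_type S) (fun f => set_val f).
- by move=> f; apply: Scont; exact: set_valP.
- by rewrite /card_lt (card_le_eql (card_setT S)) (card_le_eqr (card_setT S)).
have [y [mu [_ mupos]]] := images L p hL cp rp wL.
have fac f : S f -> exists2 h : L -> R, continuous h & f = h \o p.
  by move=> Sf; exact: (ph (SigSub (mem_set Sf))).
have mclosed (D : set L) : closed D -> measurable (D : set (borel y)).
  move=> cD; rewrite -[D]setCK; apply: measurableC; apply: sub_sigma_algebra.
  exact: closed_openC.
have mimg C : closed C -> measurable (p @` C : set (borel y)).
  move=> cC; apply: mclosed; apply: compact_closed => //.
  apply: continuous_compact; first exact: continuous_subspaceT.
  exact: subclosed_compact cK _.
exists (fun C => mu (p @` C : set (borel y))); split.
- by move=> C; exact: measure_ge0.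
- by rewrite image_set0 measure0.
- by rewrite rp probability_setT.
- move=> C D cC cD CD; apply: le_measure; rewrite ?inE; [exact: mimg|exact: mimg|].
  exact: image_subset.
- by move=> C D cC cD; rewrite image_setU; apply: measureU2; exact: mimg.
(* The factor [h] of [f] is 0 on the image of [C] and 1 on that of [D], so the images are
   disjoint. *)
- move=> f C D /fac[h _ ->] cC cD C0 D1; rewrite image_setU.
  apply: measureU; [exact: mimg|exact: mimg|].
  apply/seteqP; split => // _ [[c Cc <-] [d Dd dc]].
  have /= h0 : (h \o p) c = 0%R by apply: C0; exists c.
  have /= h1 : (h \o p) d = 1%R by apply: D1; exists d.
  by move: h1; rewrite dc h0 => /esym/eqP; rewrite oner_eq0.
- move=> f x Sf fx; have [h ch fh] := fac f Sf.
  have cf := Scont _ Sf.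
  (* Strictness makes [V] open; it contains [p x], and by surjectivity of [p] it lies in the image
     of the set where [f] is at least 1/2. *)
  pose V := [set z | (2^-1 < h z)%R].
  have oV : open V.
    by apply: (@open_comp _ _ h [set r | (2^-1 < r)%R]) => // z _; exact: ch.
  have cC : closed [set z | (2^-1 <= f z)%R].
    by apply: (@closed_comp _ _ f [set r | (2^-1 <= r)%R]) => // z _; exact: cf.
  have V0 : V !=set0.
    exists (p x); rewrite /V /= -[h (p x)]/((h \o p) x) -fh fx.
    by rewrite invf_lt1// ltr1n.
  apply: lt_le_trans (mupos _ oV V0) _.
  apply: le_measure; rewrite ?inE.
  + exact: sub_sigma_algebra.
  + exact: mimg.
  + move=> z Vz; have [w _ wz] : range p z by rewrite rp.
    exists w => //=; rewrite fh /= wz; exact: ltW.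
Qed.

Lemma almost_sure_ae (R : realType) d (T : measurableType d)
    (P : probability T R) (E : set T) (Q : T -> Prop) :
  measurable E -> P E = 1 -> (forall t, E t -> Q t) -> {ae P, forall t, Q t}.
Proof.
move=> mE PE EQ; exists (~` E); split; first exact: measurableC.
- by rewrite probability_setC// PE subee.
- by move=> t /= nQ /EQ.
Qed.

(** All laws but additivity hold for every [A] and pass to the integral. For disjoint [C] and [D],
    Urysohn's lemma gives one separating [f], and almost every [A] contains it. *)
Lemma integral_closed_content (R : realType) (K : topologicalType)
    (k : small_subset {f : K -> R | continuous f} -> set K -> \bar R)
    (lambda : probability (small_subset {f : K -> R | continuous f}) R) :
  hausdorff_space K -> compact [set: K] ->
  (forall f, lambda [set A | set_val A f] = 1) ->
  (forall A, separated_content (sval @` set_val A) (k A)) ->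
  closed_content (fun C => \int[lambda]_A k A C).
Proof.
move=> hK cK lam1 kS; split.
- by move=> C; apply: integral_ge0 => A _; exact: scontent_ge0 (kS A) C.
- by apply: integral0_eq => A _; exact: scontent0 (kS A).
- rewrite (eq_integral (cst 1)); last by move=> A _; exact: scontentT (kS A).
  by rewrite integral_cst// mul1e; exact: probability_setT.
- move=> C D cC cD CD; apply: ge0_le_integral => //.
  + by move=> A _; exact: scontent_ge0 (kS A) C.
  + by move=> A _; exact: scontent_le (kS A) C D cC cD CD.
- move=> C D cC cD; rewrite -ge0_integralD//; last 2 first.
  + by move=> A _; exact: scontent_ge0 (kS A) C.
  + by move=> A _; exact: scontent_ge0 (kS A) D.
  apply: ge0_le_integral => //.
  + by move=> A _; exact: scontent_ge0 (kS A) _.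
  + by move=> A _; exact: scontentU_le (kS A) C D cC cD.
- move=> C D cC cD CD0; rewrite -ge0_integralD//; last 2 first.
  + by move=> A _; exact: scontent_ge0 (kS A) C.
  + by move=> A _; exact: scontent_ge0 (kS A) D.
  have := (@normal_separatorP R K).1 (compact_normal hK cK) C D cC cD CD0.
  move=> /(@uniform_separatorP _ R)[f [cf _ f0 f1]].
  apply: ge0_ae_eq_integral => //.
  + by move=> A _; exact: scontent_ge0 (kS A) _.
  + by move=> A _; apply: adde_ge0; exact: scontent_ge0 (kS A) _.
  apply: (almost_sure_ae _ (lam1 (exist _ f cf))) => // A Af _.
  by apply: (scontentU_sep (kS A)) f0 f1 => //; exists (exist _ f cf).
Qed.

(** A zero integral would make [k A C] vanish for almost every [A], yet it is positive whenever [A]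
    contains [f], an event of measure 1. *)
Lemma integral_content_gt0 (R : realType) (K : topologicalType)
    (k : small_subset {f : K -> R | continuous f} -> set K -> \bar R)
    (lambda : probability (small_subset {f : K -> R | continuous f}) R)
    (f : K -> R) (x : K) :
  (forall f, lambda [set A | set_val A f] = 1) ->
  (forall A, separated_content (sval @` set_val A) (k A)) ->
  continuous f -> f x = 1%R ->
  0 < \int[lambda]_A k A [set y | (2^-1 <= f y)%R].
Proof.
move=> lam1 kS cf fx; set C := [set y | _].
have k0 A : 0 <= k A C by exact: scontent_ge0 (kS A) C.
rewrite lt0e integral_ge0// andbT; apply/eqP => int0.
have : \int[lambda]_A `|k A C| = 0.
  by rewrite -[RHS]int0; apply: eq_integral => A _; rewrite gee0_abs.
move=> /ae_eq_integral_abs-/(_ measurableT)[]// N [mN N0 sub].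
have : lambda [set A | set_val A (exist _ f cf)] <= lambda N.
  apply: le_measure; rewrite ?inE// => A Af; apply: sub => /= /(_ I) kA0.
  have : 0 < k A C.
    by apply: (scontent_gt0 (kS A)) fx; exists (exist _ f cf).
  by rewrite kA0 ltxx.
by rewrite lam1 N0 lee_fin ler10.
Qed.

Theorem theorem2p3 (R : realType) (nma : NMA_minus R) (K : topologicalType)
    (K_compact : compact [set: K]) (K_hausdorff : hausdorff_space K)
    (images : forall (L : topologicalType) (f : K -> L),
      hausdorff_space L -> continuous f -> range f = [set: L] ->
      weight_lt L continuum -> carries_strictly_positive_measure R L) :
  carries_strictly_positive_measure R K.
Proof.
have [lambda lam1] := nma {f : K -> R | continuous f}.
have /choice[k kS] : forall A : small_subset {f : K -> R | continuous f},
    exists k, separated_content (sval @` set_val A) k.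
  move=> A; apply: (@image_separated_content R K images) => //.
    (* Forgetting the continuity proofs maps [A] onto a set of plain functions, which is no
       larger. *)
    have [Ac cA] : card_lt (set_val A) continuum := set_valP A.
    have le := card_image_le (@sval (K -> R) (fun f => continuous f)) (set_val A).
    split; first exact: card_le_trans le Ac.
    by move=> cA'; apply: cA; exact: card_le_trans cA' le.
  by move=> _ [f _ <-]; exact: (svalP f).
(* On an empty [K] the whole space would have content both 0 and 1. *)
have [x _] : [set: K] !=set0.
  apply/set0P/eqP => K0; have := scontentT (kS point).
  by rewrite K0 (scontent0 (kS point)) => /eqP; rewrite eqe eq_sym oner_eq0.
have kc := integral_closed_content K_hausdorff K_compact lam1 kS.
have [mu mureg kmu] := closed_content_measure x K_hausdorff K_compact kc.
exists x, mu; split => // V oV [v Vv].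
have cV : closed (~` V) by exact: open_closedC.
have cv : closed [set v].
  by apply: compact_closed => //; exact: compact_set1.
have V0 : ~` V `&` [set v] = set0.
  by apply/seteqP; split => // z [nVz zv]; case: nVz; rewrite zv.
(* Urysohn's function is 0 off [V] and 1 at [v], so the closed set where it is at least 1/2 lies in
   [V] and has positive content. *)
have := (@normal_separatorP R K).1 (compact_normal K_hausdorff K_compact) _ _ cV cv V0.
move=> /(@uniform_separatorP _ R)[f [cf _ f0 f1]].
have fv : f v = 1%R by apply: f1; exists v.
apply: lt_le_trans (integral_content_gt0 lam1 kS cf fv) _.
apply: kmu => //.
  by apply: (@closed_comp _ _ f [set r | (2^-1 <= r)%R]) => // z _; exact: cf.
move=> z /= fz; apply: contrapT => nVz.
have fz0 : f z = 0%R by apply: f0; exists z.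
by move: fz; rewrite fz0 invr_le0 lern0.
Qed.
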